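(* There is a universal constant $K$ such that every connected edge-weighted graph $G=(V,E,w)$ on $n\ge2$ vertices, with minimum pairwise distance $1$, admits a $\gamma$-hierarchy of strong $(\alpha,\tau)$-sparse partitions for some $\alpha,\tau\le K\log n$ and $\gamma\le K\log^2 n$ (that is, $\alpha=\tau=O(\log n)$ and $\gamma=O(\log^2 n)$).
   Context: Graphs are finite and undirected with positive edge weights; $d_G$ is the shortest-path distance, $B_G(v,r)=\{u: d_G(u,v)\le r\}$, and $G[C]$ is the subgraph induced by $C\subseteq V$. It is assumed (by scaling) that the minimum distance between distinct vertices of $G$ is $1$. A strong $\Delta$-diameter $(\alpha,\tau)$-sparse partition of $G$ is a partition $\mathcal C$ of $V$ such that: (1) for every $C\in\mathcal C$ the induced graph $G[C]$ has diameter at most $\Delta$ (distances measured in $G[C]$); (2) for every $v\in V$, the ball $B_G(v,\Delta/\alpha)$ intersects at most $\tau$ clusters of $\mathcal C$. A $\gamma$-hierarchy of strong $(\alpha,\tau)$-sparse partitions consists of partitions $\{\{v\}:v\in V\}=\mathcal C_0,\mathcal C_1,\dots,\mathcal C_k=\{V\}$ of $V$ such that: (1) $\mathcal C_i$ is a strong $\gamma^i$-diameter $(\alpha,\tau)$-sparse partition for every $i$; (2) $\mathcal C_{i+1}$ coarsens $\mathcal C_i$, i.e. each $U\in\mathcal C_i$ is contained in some $U'\in\mathcal C_{i+1}$. *)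

(* Defs.v *)
From HB Require Import structures.
From mathcomp Require Import all_boot all_order all_algebra.
From mathcomp Require Import classical_sets reals constructive_ereal ereal exp.

Set Implicit Arguments.
Unset Strict Implicit.
Unset Printing Implicit Defensive.

Import Order.TTheory GRing.Theory Num.Theory.
Local Open Scope ring_scope.

Record wgraph (R : realType) (V : finType) := WGraph {
  adj : rel V;
  weight : V -> V -> R;
  adj_sym : symmetric adj;
  adj_irr : irreflexive adj;
  weight_sym : forall u v, weight u v = weight v u;
  weight_gt0 : forall u v, adj u v -> 0 < weight u v
}.

Definition connected_graph (R : realType) (V : finType) (G : wgraph R V) :=
  forall u v, connect (adj G) u v.

Definition walk_length (R : realType) (V : finType) (G : wgraph R V)
  (u : V) (p : seq V) : R := \sum_(l <- pairmap (weight G) u p) l.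

(* The distance is +oo between vertices in different components. *)
Definition gdist (R : realType) (V : finType) (G : wgraph R V) (u v : V)
    : \bar R :=
  ereal_inf [set (walk_length G u p)%:E | p in
              [set p : seq V | path (adj G) u p /\ last u p = v]]%classic.

Definition gball (R : realType) (V : finType) (G : wgraph R V) (v : V) (r : R)
  : {set V} := [set u | (gdist G u v <= r%:E)%E].

Definition diameter (R : realType) (V : finType) (G : wgraph R V) : \bar R :=
  ereal_sup [set gdist G x.1 x.2 | x in [set: V * V]]%classic.

Definition min_distance_one (R : realType) (V : finType) (G : wgraph R V) :=
  (exists u v : V, u != v /\ gdist G u v = 1%:E) /\
  (forall u v : V, u != v -> (1%:E <= gdist G u v)%E).

Section Induced.
Variables (R : realType) (V : finType) (G : wgraph R V) (C : {set V}).

Let T := {x : V | x \in C}.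

Definition induced_adj : rel T := fun x y => adj G (val x) (val y).
Definition induced_weight (x y : T) : R := weight G (val x) (val y).

Lemma induced_adj_sym : symmetric induced_adj.
Proof. by move=> x y; exact: adj_sym. Qed.

Lemma induced_adj_irr : irreflexive induced_adj.
Proof. by move=> x; exact: adj_irr. Qed.

Lemma induced_weight_sym x y : induced_weight x y = induced_weight y x.
Proof. exact: weight_sym. Qed.

Lemma induced_weight_gt0 x y : induced_adj x y -> 0 < induced_weight x y.
Proof. exact: weight_gt0. Qed.

Definition induced : wgraph R {x : V | x \in C} :=
  WGraph induced_adj_sym induced_adj_irr induced_weight_sym induced_weight_gt0.

End Induced.

Definition strong_sparse_partition (R : realType) (V : finType)
    (G : wgraph R V) (Delta alpha tau : R) (P : {set {set V}}) : Prop :=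
  [/\ finset.partition P [set: V],
      forall C, C \in P -> (diameter (induced G C) <= Delta%:E)%E
    & forall v : V,
        #|[set C in P | ~~ [disjoint C & gball G v (Delta / alpha)]]|%:R <= tau].

(* Only C 0, ..., C k are meaningful; the values of C beyond k are ignored. *)
Definition sparse_hierarchy (R : realType) (V : finType) (G : wgraph R V)
    (gamma alpha tau : R) (k : nat) (C : nat -> {set {set V}}) : Prop :=
  [/\ C 0%N = [set [set v] | v : V],
      C k = [set [set: V]],
      forall i, (i <= k)%N ->
        strong_sparse_partition G (gamma ^+ i) alpha tau (C i)
    & forall i, (i < k)%N -> forall U, U \in C i ->
        exists2 U', U' \in C i.+1 & U \subset U'].

(* Main.v *)
(** Write n = #|V|.  A level of the hierarchy, with clusters of strong diameter
    Delta, is coarsened by assigning every cluster to a "portal" vertex.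

    Sparsity: give each vertex u a head start rho * lev u, where lev <= O(log n)
    is built by repeatedly thinning V so that at every v only O(log n) portals
    come within rho of the best value of d(v,u) - rho * lev u.

    Strong diameter: the assignment is made in O(log n) phases.  In each phase
    every portal p gets an extra head start O(Delta) * d p such that at half of
    the unassigned vertices one portal wins by a margin of 2 Delta.  The
    clusters of these vertices are assigned to the winner; the margin ensures
    that the paths to the winner run only through clusters it gets.  The
    potential sum_p (7/6)^(total head start of p) grows by a factor 8 per phase,
    so all head starts are O(log n) Delta, and so is the total loss.

    With rho = Theta(log n) Delta exceeding this loss, the new clusters have
    radius O(log n) rho = O(log^2 n) Delta, and a ball of radius rho/8 meets
    only clusters of the O(log n) near-optimal portals at its centre. *)
Require Import Defs.
From HB Require Import structures.
From mathcomp Require Import boolp classical_sets reals constructive_ereal ereal exp.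
From mathcomp Require Import all_boot all_order all_algebra.
From mathcomp Require Import ring lra zify.

Set Implicit Arguments.
Unset Strict Implicit.
Unset Printing Implicit Defensive.
Import Order.TTheory GRing.Theory Num.Theory.
Local Open Scope ring_scope.

(** * Separating shifts *)

Lemma argmax_bounded_fun (R : realType) (P : finType) (N : nat)
    (J : (P -> nat) -> R) :
  exists2 d : P -> nat, (forall p, d p <= N)%N &
    forall d', (forall p, d' p <= N)%N -> J d' <= J d.
Proof.
pose ev (f : {ffun P -> 'I_N.+1}) (p : P) := val (f p).
exists (ev [arg max_(f > [ffun=> ord0] : {ffun P -> 'I_N.+1}) J (ev f)])%O.
  by move=> p; rewrite -ltnS; exact: ltn_ord.
case: arg_maxP => // f _ fmax d' d'N.
have -> : d' = ev [ffun p => inord (d' p)].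
  by apply/funext => p; rewrite /ev ffunE /= inordK ?ltnS.
exact: fmax.
Qed.

Lemma bernoulli_ge (R : realType) (x : R) n : 0 <= x -> 1 + x *+ n <= (1 + x) ^+ n.
Proof.
move=> x0; elim: n => [|n IH]; first by rewrite mulr0n addr0.
rewrite exprS mulrS.
have := ler_wpM2l (addr_ge0 ler01 x0) IH; apply: le_trans.
have : 0 <= x * (x *+ n) by rewrite mulr_ge0 ?mulrn_wge0.
by rewrite mulrDl mul1r mulrDr mulr1; lra.
Qed.

Lemma geometric_unbounded (R : realType) (c b : R) : 1 < c -> exists n, b < c ^+ n.
Proof.
move=> c1; have x0 : 0 < c - 1 by lra.
exists (Num.truncn (b / (c - 1))).+1.
have := @bernoulli_ge R (c - 1) (Num.truncn (b / (c - 1))).+1 (ltW x0).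
rewrite [1 + (c - 1)]addrC subrK; apply: lt_le_trans.
have := truncnS_gt (b / (c - 1)); rewrite ltr_pdivrMr // mulrC mulr_natr => h.
by apply: lt_trans h _; lra.
Qed.

Lemma sum_pred1 (R : realType) (P : finType) (p : P) :
  \sum_q (p == q)%:R = 1 :> R.
Proof.
by rewrite (bigD1 p) //= eqxx big1 ?addr0 // => q /negPf; rewrite eq_sym => ->.
Qed.

Section Shifts.
Variables (R : realType) (I P : finType) (U : {set I}).
Variables (ok : I -> pred P) (a : I -> P -> R) (W : P -> R).
Hypothesis okU : forall i, i \in U -> exists p, ok i p.
Hypothesis W_gt0 : forall p, 0 < W p.
Implicit Types (d : P -> nat) (i : I) (p q : P).

Definition separated d i := [exists p, ok i p &&
  [forall q, (q != p) && ok i q ==> (a i p - (d p)%:R + 1/2 <= a i q - (d q)%:R)]].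

Lemma best_exists (p0 : P) : exists best : (P -> nat) -> I -> P,
  forall d i, i \in U -> ok i (best d i) /\
    forall q, ok i q -> (d q)%:R - a i q <= (d (best d i))%:R - a i (best d i).
Proof.
exists (fun d i => if [pick p | ok i p] is Some p1
  then [arg max_(p > p1 | ok i p) ((d p)%:R - a i p)]%O else p0).
move=> d i /okU[p okp]; case: pickP => [p1 okp1|/(_ p)]; last by rewrite okp.
by case: arg_maxP.
Qed.

Let c : R := 7 / 6.

(* [d] is a maximiser of sum_i max_p (d p - a i p) - s * sum_p W p * c ^ d p.
   Raising [d p] by one gains 1 on every [i] won by [p], lowering it costs at
   most 1 on these and less than 1/2 on the unseparated ones; as the penalty
   grows by the factor [c], both moves being unprofitable forces the
   unseparated indices to be a small fraction. *)
Lemma separating_shifts : exists d,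
  (2 * #|[set i in U | ~~ separated d i]| <= #|U|)%N /\
  \sum_p W p * c ^+ d p <= 8 * \sum_p W p.
Proof.
have c1 : 1 < c by rewrite /c; lra.
have c0 : 0 < c by lra.
have [->|[i0 i0U]] := set_0Vmem U.
  exists (fun=> 0%N); split.
    by rewrite eq_card0 // => i; rewrite !inE.
  rewrite mulr_sumr; apply: ler_sum => p _; rewrite expr0 mulr1.
  by have := W_gt0 p; lra.
have [p0 _] := okU i0U.
have SW : 0 < \sum_p W p.
  by rewrite (bigD1 p0) //= ltr_pwDl // sumr_ge0 // => p _; apply/ltW.
have U0 : 0 < #|U|%:R :> R by rewrite ltr0n; apply/card_gt0P; exists i0.
(* With this scaling [\sum_p s * W p] equals [#|U|], so both conclusions follow by summing bounds
   per portal. *)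
pose s := #|U|%:R / \sum_p W p.
have s0 : 0 < s by rewrite divr_gt0.
have [best bestP] := best_exists p0.
pose M d i := (d (best d i))%:R - a i (best d i).
pose J d := \sum_(i in U) M d i - s * \sum_p W p * c ^+ d p.
(* [N] makes the search space finite; it is so large that [d p = N] would contradict [lower], so
   raising a shift by one is always allowed. *)
have [N N0 NP] : exists2 N, (0 < N)%N & forall p, 7 * #|U|%:R < s * W p * c ^+ N.
  have /choice[f fP] : forall p, exists n, 7 * #|U|%:R / (s * W p) < c ^+ n.
    by move=> p; apply: geometric_unbounded.
  exists (\max_p f p).+1 => // p.
  have sW : 0 < s * W p by rewrite mulr_gt0.
  have := fP p; rewrite ltr_pdivrMr // [ltRHS]mulrC => /lt_le_trans; apply.
  rewrite ler_pM2l // ler_weXn2l ?ltW // leqW //; exact: leq_bigmax.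
have [d dN dmax] := argmax_bounded_fun N J.
pose n_ p : R := \sum_(i in U) (best d i == p)%:R.
pose b_ p : R := \sum_(i in U | ~~ separated d i) (best d i == p)%:R.
have bn p : b_ p <= n_ p.
  rewrite /b_ /n_ big_mkcondr /=; apply: ler_sum => i _.
  by case: separated.
have nU p : n_ p <= #|U|%:R.
  rewrite /n_ -sumr_const; apply: ler_sum => i _; by case: eqP => _ /=.
have sum_n : \sum_p n_ p = #|U|%:R.
  rewrite exchange_big /= -sumr_const; apply: eq_bigr => i _; exact: sum_pred1.
have sum_b : \sum_p b_ p = #|[set i in U | ~~ separated d i]|%:R.
  rewrite exchange_big /= -sumr_const big_set /=.
  by apply: eq_bigr => i _; exact: sum_pred1.
pose y p := s * W p * c ^+ d p.
have y0 p : 0 < y p by rewrite /y; apply: mulr_gt0; [apply: mulr_gt0|apply: exprn_gt0].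
pose upd p k q := if q == p then k else d q.
have cost p k : s * (\sum_q W q * c ^+ upd p k q) =
    s * (\sum_q W q * c ^+ d q) - y p + s * W p * c ^+ k.
  rewrite (bigD1 p) //= [in RHS](bigD1 p) //= /upd eqxx /y.
  rewrite (eq_bigr (fun q => W q * c ^+ d q)); first by ring.
  by move=> q /negPf ->.
have lower p : (0 < d p)%N -> y p / 7 <= n_ p - b_ p / 2.
  move=> dp0; have /dmax : forall q, (upd p (d p).-1 q <= N)%N.
    by move=> q; rewrite /upd; case: eqP => // _; rewrite (leq_trans (leq_pred _)).
  rewrite /J cost.
  have -> : s * W p * c ^+ (d p).-1 = 6 / 7 * y p.
    by rewrite /y -[in RHS](prednK dp0) exprS /c; field.
  suff : \sum_(i in U) M (upd p (d p).-1) i >=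
     \sum_(i in U) M d i - (n_ p - b_ p / 2) by lra.
  rewrite /n_ /b_ big_mkcondr /= mulr_suml -!sumrB; apply: ler_sum => i iU.
  have [okb bestb] := bestP d i iU.
  have [_ bestu] := bestP (upd p (d p).-1) i iU.
  have [bp|bp] := eqVneq (best d i) p; last first.
    have := bestu _ okb; rewrite /M /upd (negPf bp).
    by case: separated => /=; lra.
  case: ifPn => [sep|_] /=; last first.
    have := bestu _ okb; rewrite /M {1}/upd bp eqxx.
    have -> : (d p)%:R = (d p).-1%:R + 1 :> R by rewrite natr1 prednK.
    lra.
  move: sep; rewrite negb_exists => /forallP/(_ p).
  rewrite -{1}bp okb /= negb_forall => /existsP[q].
  rewrite negb_imply -ltNge => /andP[/andP[qp okq] ltq].
  by have := bestu _ okq; rewrite /M {1}/upd (negPf qp) bp; lra.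
have upper p : n_ p <= y p / 6.
  have dpN : (d p < N)%N.
    rewrite ltn_neqAle dN andbT; apply/eqP => dpN.
    have dp0 : (0 < d p)%N by rewrite dpN.
    have := lower p dp0; have := NP p; have := nU p; have := y0 p.
    have b0 : 0 <= b_ p by apply: sumr_ge0.
    by rewrite {1 2}/y dpN; lra.
  have /dmax : forall q, (upd p (d p).+1 q <= N)%N.
    by move=> q; rewrite /upd; case: eqP.
  rewrite /J cost.
  have -> : s * W p * c ^+ (d p).+1 = 7 / 6 * y p by rewrite /y exprS /c; ring.
  suff : \sum_(i in U) M d i + n_ p <= \sum_(i in U) M (upd p (d p).+1) i by lra.
  rewrite -big_split /=; apply: ler_sum => i iU.
  have [okb bestb] := bestP d i iU.
  have [_ /(_ _ okb)] := bestP (upd p (d p).+1) i iU.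
  rewrite /M {1}/upd; case: eqVneq => [->|_] /=; last by lra.
  by rewrite -natr1; lra.
(* For positive [d p], [lower] and [upper] give [b_ p <= 2 / 7 * n_ p]; for [d p = 0], [upper]
   bounds [n_ p] itself. In total 2/7 + 1/6 < 1/2. *)
have few p : b_ p <= 2 / 7 * n_ p + s * W p / 6.
  have [dp0|dp0] := posnP (d p).
    have n0 : 0 <= n_ p by apply: sumr_ge0.
    by have := upper p; have := bn p; rewrite /y dp0 expr0; lra.
  have sW : 0 < s * W p by rewrite mulr_gt0.
  by have := lower p dp0; have := upper p; lra.
have small p : y p <= 7 * n_ p + s * W p.
  have n0 : 0 <= n_ p by apply: sumr_ge0.
  have sW : 0 < s * W p by rewrite mulr_gt0.
  have b0 : 0 <= b_ p by apply: sumr_ge0.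
  have [dp0|dp0] := posnP (d p); first by rewrite /y dp0 expr0; lra.
  by have := lower p dp0; lra.
have sumsW : \sum_p s * W p = #|U|%:R.
  by rewrite -mulr_sumr /s divfK ?gt_eqF.
exists d; split.
  rewrite -(ler_nat R) natrM -sum_b.
  have : \sum_p b_ p <= \sum_p (2 / 7 * n_ p + s * W p / 6).
    by apply: ler_sum => p _; exact: few.
  rewrite big_split /= -mulr_sumr -mulr_suml sum_n sumsW. lra.
have sum_y : s * \sum_p W p * c ^+ d p = \sum_p y p.
  by rewrite mulr_sumr; apply: eq_bigr => p _; rewrite mulrA.
rewrite -(ler_pM2l s0) sum_y mulrCA mulr_sumr sumsW.
have : \sum_p y p <= \sum_p (7 * n_ p + s * W p).
  by apply: ler_sum => p _; exact: small.
by rewrite big_split /= -mulr_sumr sum_n sumsW; lra.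
Qed.

End Shifts.

(** * Sparse level functions *)

Lemma powerset_split (R : realType) (T : finType) (S : {set T}) h
    (F : {set T} -> R) : h \in S ->
  \sum_(A in powerset S) F A = \sum_(A in powerset (S :\ h)) (F A + F (h |: A)).
Proof.
move=> hS; rewrite big_split /= (bigID (fun A : {set T} => h \in A)) /= addrC.
congr (_ + _).
  apply: eq_bigl => A; rewrite !powersetE subsetD1; by case: (h \in A).
rewrite (reindex_onto (fun A => h |: A) (fun A => A :\ h)) /=; last first.
  by move=> A /andP[_ hA]; rewrite setD1K.
apply: eq_bigl => A; rewrite !powersetE subsetD1 setU11 andbT subUset sub1set hS /=.
have [hA|hA] := boolP (h \in A); last by rewrite setU1K // eqxx.
rewrite andbF; apply/negP => /andP[_ /eqP/setP/(_ h)].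
by rewrite !inE eqxx hA.
Qed.

Lemma sum_card_powerset (R : realType) (T : finType) (S : {set T}) :
  2 * \sum_(A in powerset S) #|A|%:R = #|S|%:R * 2 ^+ #|S| :> R.
Proof.
elim: {S}_.+1 {-2}S (ltnSn #|S|) => // n IH S; rewrite ltnS => Sn.
have [->|[h hS]] := set_0Vmem S.
  by rewrite powerset0 big_set1 !cards0 mulr0 mul0r.
have Sh : #|S| = (#|S :\ h|).+1 by rewrite (cardsD1 h) hS.
rewrite (powerset_split _ hS).
under eq_bigr => A.
  rewrite powersetE subsetD1 => /andP[_ hA]; rewrite cardsU1 hA add1n -natr1 addrA.
  over.
rewrite !big_split /= sumr_const card_powerset.
have := IH (S :\ h); rewrite -Sh => /(_ Sn); rewrite Sh exprS natrX -natr1.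
lra.
Qed.

Definition nearer (R : realType) (T : finType) (S A : {set T}) (a : T -> R) :=
  [set u in S | [forall u' in A, a u < a u']].

(** Remove the closest point [h] of [S]. Subsets containing [h] leave nothing nearer and contribute
    1 each; in the others [h] adds at most one to the count. The induction closes because 3/2 * 2 +
    1 = 2 * 2. *)
Lemma sum_expr_nearer (R : realType) (T : finType) (S : {set T}) (a : T -> R) :
  \sum_(A in powerset S) (3 / 2) ^+ #|nearer S A a| <= 2 * 2 ^+ #|S| :> R.
Proof.
elim: {S}_.+1 {-2}S (ltnSn #|S|) => // n IH S; rewrite ltnS => Sn.
have [->|[h0 h0S]] := set_0Vmem S.
  rewrite powerset0 big_set1 cards0 [X in _ ^+ X](_ : _ = 0%N) ?expr0; first by lra.
  by apply: eq_card0 => u; rewrite !inE.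
have [h hS hmin] : exists2 h, h \in S & forall u, u \in S -> a h <= a u.
  by exists [arg min_(u < h0 in S) a u]%O; case: arg_minP.
have Sh : #|S| = (#|S :\ h|).+1 by rewrite (cardsD1 h) hS.
rewrite (powerset_split _ hS).
have := IH (S :\ h); rewrite -Sh => /(_ Sn) {}IH.
apply: le_trans (_ : \sum_(A in powerset (S :\ h))
   (3 / 2 * (3 / 2) ^+ #|nearer (S :\ h) A a| + 1) <= _).
  apply: ler_sum => A _; apply: lerD.
    rewrite -exprS ler_weXn2l //; first by lra.
    apply: (@leq_trans #|h |: nearer (S :\ h) A a|).
      apply/subset_leq_card/fintype.subsetP => u; rewrite !inE => /andP[-> ->].
      by rewrite !andbT orbN.
    by rewrite cardsU1 -add1n leq_add2r; case: (_ \notin _).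
  rewrite [X in _ ^+ X](_ : _ = 0%N) ?expr0 //.
  apply: eq_card0 => u; rewrite !inE; apply/negP => /andP[uS /forall_inP/(_ h)].
  by rewrite setU11 => /(_ isT); rewrite ltNge hmin.
rewrite big_split /= -mulr_sumr sumr_const card_powerset Sh exprS natrX; lra.
Qed.

(* Minimise the average-bounded quantity
   |S| * sum_i w i * (3/2) ^ x_i(A) + 4 * |A| * sum_i w i over subsets A of S. *)
Lemma halving_subset (R : realType) (I T : finType) (S : {set T}) (a : I -> T -> R)
    (w : I -> R) : (forall i, 0 < w i) -> (0 < #|I|)%N ->
  exists S' : {set T}, [/\ S' \subset S, (4 * #|S'| <= 3 * #|S|)%N &
    \sum_i w i * (3 / 2) ^+ #|nearer S S' (a i)| <= 4 * \sum_i w i].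
Proof.
move=> w0 /card_gt0P[i0 _].
have W0 : 0 < \sum_i w i.
  by rewrite (bigD1 i0) //= ltr_pwDl // sumr_ge0 // => p _; apply/ltW.
pose Phi A := \sum_i w i * (3 / 2) ^+ #|nearer S A (a i)|.
pose F A := Phi A * #|S|%:R + 4 * #|A|%:R * \sum_i w i.
have [S0|S0] := posnP #|S|.
  exists set0; rewrite sub0set cards0; split => //.
  rewrite mulr_sumr; apply: ler_sum => i _.
  rewrite [X in _ ^+ X](_ : _ = 0%N) ?expr0; first by have := w0 i; lra.
  by move/cards0_eq: S0 => ->; apply: eq_card0 => u; rewrite !inE.
have S0R : 0 < #|S|%:R :> R by rewrite ltr0n.
(* On average [Phi A] is at most [2 * \sum_i w i] and [4 * #|A|] is [2 * #|S|], so each summand of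
   [F] takes half of the bound. *)
have sumF : \sum_(A in powerset S) F A <= \sum_(A in powerset S) (4 * #|S|%:R * \sum_i w i).
  rewrite sumr_const card_powerset -[leRHS]mulr_natr natrX big_split /= -!mulr_suml -mulr_sumr.
  have PhiS : \sum_(A in powerset S) Phi A <= 2 * 2 ^+ #|S| * \sum_i w i.
    rewrite exchange_big /= mulr_sumr; apply: ler_sum => i _.
    by rewrite -mulr_sumr [leRHS]mulrC ler_pM2l // sum_expr_nearer.
  have := sum_card_powerset R S.
  have := ler_wpM2r (ltW S0R) PhiS.
  set x := \sum_(_ in _) Phi _; set y := \sum_(_ in _) _%:R.
  move=> hx hy; have -> : 4 * y = 2 * (#|S|%:R * 2 ^+ #|S|) by rewrite -hy; ring.
  by lra.
have [A] : exists2 A, A \in powerset S & F A <= 4 * #|S|%:R * \sum_i w i.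
  apply: contrapT => noA.
  have {}noA A : A \in powerset S -> 4 * #|S|%:R * \sum_i w i < F A.
    by move=> AS; rewrite ltNge; apply/negP => FA; apply: noA; exists A.
  move: sumF; apply/negP; rewrite -ltNge.
  have set0S : set0 \in powerset S by rewrite powersetE sub0set.
  rewrite (bigD1 set0) //= [ltRHS](bigD1 set0) //= ltr_leD ?noA //.
  by apply: ler_sum => A /andP[AS _]; exact/ltW/noA.
rewrite powersetE => AS FA; exists A.
(* All powers are at least 1, so the first summand of [F A] uses at least a quarter of the bound,
   which leaves [4 * #|A| <= 3 * #|S|]. *)
have PhiA : \sum_i w i <= Phi A.
  apply: ler_sum => i _; apply: ler_peMr; first exact: ltW.
  by apply: exprn_ege1; lra.
split => //.
  rewrite -(ler_nat R) !natrM -(ler_pM2r W0).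
  have := ler_wpM2r (ltW S0R) PhiA; rewrite /F in FA; nra.
rewrite -(ler_pM2r S0R); have : 0 <= 4 * #|A|%:R * \sum_i w i.
  by rewrite !mulr_ge0 // ltW.
by rewrite /F /Phi in FA *; nra.
Qed.

(* A portal [u] is counted at [i] only if no portal of higher level is at least
   as close: otherwise the latter beats it by a full level. *)
Lemma sparse_levels (R : realType) (I T : finType) (a : I -> T -> R) (L : nat) :
  (0 < #|I|)%N -> forall (S : {set T}) (w : I -> R), (forall i, 0 < w i) ->
  (3 ^ L * #|S| < 4 ^ L)%N ->
  exists2 lev : T -> nat, forall u, (lev u <= L)%N &
    \sum_i w i * (3 / 2) ^+ #|[set u in S | [forall u' in S,
        (lev u < lev u')%N ==> (a i u < a i u')]]| <= 4 ^+ L * \sum_i w i.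
Proof.
move=> I0; elim: L => [|L IH] S w w0 SL.
  exists (fun=> 0%N) => //; rewrite expr0 mul1r; apply: ler_sum => i _.
  rewrite [X in _ ^+ X](_ : _ = 0%N) ?expr0 ?mulr1 //.
  move: SL; rewrite !expn0 mul1n ltnS leqn0 => /eqP/cards0_eq ->.
  by apply: eq_card0 => u; rewrite !inE.
have [S' [S'S S'c S'w]] := halving_subset S a w0 I0.
(* Folding this count into the weights makes the counts of successive thinnings add up in the
   exponent, at a factor 4 per thinning. *)
pose w' i := w i * (3 / 2) ^+ #|nearer S S' (a i)|.
have w'0 i : 0 < w' i by rewrite mulr_gt0 // exprn_gt0 //; lra.
have S'L : (3 ^ L * #|S'| < 4 ^ L)%N.
  by move: SL S'c; rewrite !expnS; nia.
have [lev levL levw] := IH S' w' w'0 S'L.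
exists (fun u => if u \in S' then (lev u).+1 else 0%N).
  by move=> u; case: ifP => // _; rewrite ltnS.
apply: le_trans (_ : 4 ^+ L * \sum_i w' i <= _); last first.
  by rewrite exprSr -mulrA ler_wpM2l ?exprn_ge0.
apply: le_trans levw; apply: ler_sum => i _.
rewrite /w' -mulrA -exprD (ler_wpM2l (ltW (w0 i))) // ler_weXn2l //; first by lra.
apply: leq_trans (leq_card_setU _ _); apply: subset_leq_card.
apply/subsetP => u; rewrite !inE => /andP[uS /forall_inP uP].
rewrite uS /=; case: ifPn uP => uS' uP; apply/orP; [right|left] => /=;
  apply/forall_inP => u' u'S'; have := uP u' (fintype.subsetP S'S _ u'S'); rewrite u'S' //.
Qed.

(** * Walks and cluster aggregation *)

Section Walks.
Variables (R : realType) (V : finType) (G : wgraph R V).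
Implicit Types (X Y : {set V}) (u v x y z : V) (r : R).

(** Walks confined to a set are cut and joined in [G] itself; induced graphs enter only when
    diameters are read off. *)
Inductive walk X : V -> V -> R -> Prop :=
| walk_nil u : u \in X -> walk X u u 0
| walk_cons u v z r : u \in X -> adj G u v -> walk X v z r ->
    walk X u z (weight G u v + r).

Lemma walk_ge0 X u v r : walk X u v r -> 0 <= r.
Proof.
elim=> // {}u {}v z {}r _ uv _ r0; rewrite addr_ge0 //; exact/ltW/weight_gt0.
Qed.

Lemma walk_source X u v r : walk X u v r -> u \in X.
Proof. by case. Qed.

Lemma walk_subset X Y u v r : X \subset Y -> walk X u v r -> walk Y u v r.
Proof.
move=> /fintype.subsetP XY; elim=> [x /XY|x y z s /XY xY xy _ IH]; first exact: walk_nil.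
exact: walk_cons.
Qed.

Lemma walk_cat X u v z r s : walk X u v r -> walk X v z s -> walk X u z (r + s).
Proof.
elim=> [x _|x y t q xX xy _ IH /IH W]; first by rewrite add0r.
by rewrite -addrA; apply: walk_cons.
Qed.

Lemma walk_sym X u v r : walk X u v r -> walk X v u r.
Proof.
elim=> [x xX|x y z s xX xy W1 W2]; first exact: walk_nil.
rewrite addrC weight_sym -[weight _ _ _]addr0; apply: walk_cat W2 _.
apply: walk_cons (walk_nil xX); last by rewrite adj_sym.
exact: walk_source W1.
Qed.

Lemma walkP X u v r : walk X u v r <->
  exists p, [/\ path (adj G) u p, last u p = v, all (mem X) (u :: p)
              & walk_length G u p = r].
Proof.
split.
  elim=> [x xX|x y z s xX xy _ [p [pp lp Xp <-]]].
    by exists [::]; rewrite /walk_length /= big_nil xX.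
  by exists (y :: p); rewrite /walk_length /= big_cons xy xX.
move=> [p [+ <- + <-]]; elim: p u => [|x p IH] u /=.
  by rewrite andbT /walk_length big_nil => _; apply: walk_nil.
move=> /andP[ux xp] /andP[uX Xp].
by rewrite /walk_length /= big_cons; apply: walk_cons => //; apply: IH.
Qed.

End Walks.

Section Aggregation.
Variables (R : realType) (V : finType) (G : wgraph R V).
Variables (T : eqType) (cl : V -> T) (D : R) (b : V -> R).
Hypothesis D_gt0 : 0 < D.
Hypothesis clD : forall x y, cl x = cl y ->
  exists2 r, r <= D & walk G [set z | cl z == cl x] x y r.
Implicit Types (f : V -> option V) (h : V -> nat) (p q u v x y : V) (r : R).

Definition region f p := [set x | f x == Some p].

(* Walks to the portal [p] through free vertices that, once they enter the
   region of [p], stay in it. *)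
Inductive approach f p : V -> R -> Prop :=
| approach_self : f p = None -> approach f p p 0
| approach_in v r : walk G (region f p) v p r -> approach f p v r
| approach_cons v x r : f v = None -> adj G v x -> approach f p x r ->
    approach f p v (weight G v x + r).

Lemma approach_ge0 f p v r : approach f p v r -> 0 <= r.
Proof.
elim=> // [x s /walk_ge0 //|x y s _ xy _ s0].
by rewrite addr_ge0 //; exact/ltW/weight_gt0.
Qed.

Lemma approach_walk f p (X : {set V}) u v r s : {in X, forall x, f x = None} ->
  walk G X u v s -> approach f p v r -> approach f p u (s + r).
Proof.
move=> Xf; elim=> [x _|x y z t xX xy _ IH /IH H]; first by rewrite add0r.
by rewrite -addrA; apply: approach_cons => //; exact: Xf.
Qed.

Definition handicap h p := b p - 5 * D * (h p)%:R.

(** The invariant of the phases. Head starts appear on the left only, against the original costs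
    [b u], so they are paid once, at the end; [k] collects the losses of the phases. *)
Definition partial_aggregation f h (k : R) :=
  (forall x y, cl x = cl y -> f x = f y) /\
  (forall x p, f x = Some p -> exists2 r, walk G (region f p) x p r &
     forall u s, walk G setT x u s -> r + handicap h p <= s + b u + k).

(** Follow the walk to its first assigned vertex and continue to the portal of that vertex, at a
    loss of [k]; if none is met, [u] itself is approached as a portal. *)
Lemma approach_near f h k : 0 <= k -> partial_aggregation f h k ->
  forall v u s, walk G setT v u s -> exists q r,
    approach f q v r /\ r + handicap h q <= s + b u + k.
Proof.
move=> k0 [_ fk] v u s W.
have assigned x p t : f x = Some p -> walk G setT x u t -> exists q r,
    approach f q x r /\ r + handicap h q <= t + b u + k.
  move=> fx xu; have [r xp rle] := fk _ _ fx.
  by exists p, r; split; [apply: approach_in|apply: rle].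
elim: W assigned => {v u s} [u _|v x u s _ vx xu IH] assigned.
  case fu : (f u) => [p|]; first by apply: assigned fu _; apply: walk_nil.
  exists u, 0; split; first exact: approach_self.
  have : 0 <= 5 * D * (h u)%:R by rewrite mulr_ge0 // mulr_ge0 // ltW.
  by rewrite /handicap; lra.
case fv : (f v) => [p|]; first by apply: assigned fv _; apply: walk_cons.
have [q [r [xq rle]]] := IH assigned.
exists q, (weight G v x + r); split; first exact: approach_cons.
by rewrite -addrA; lra.
Qed.

(* [r] witnesses that [p] beats every other portal at [v] by [2 * D]; this is
   inherited by the free vertices along the approach and, up to a loss of [D],
   by the cluster of [v], so winning regions are made of whole clusters and
   contain the approaches they rely on. *)
Definition settled f h v p r :=
  [/\ approach f p v r, forall s, approach f p v s -> r <= s + D &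
      forall q s, q != p -> approach f q v s ->
        r + handicap h p + 2 * D <= s + handicap h q].

(** Different winners would need margins [2 * D] in both directions, but crossing the common cluster
    costs at most [D] each way. *)
Lemma settled_uniq f h v v' p p' r r' :
  (forall x y, cl x = cl y -> f x = f y) -> cl v = cl v' -> f v = None ->
  settled f h v p r -> settled f h v' p' r' -> p = p'.
Proof.
move=> fcl vv' fv [vp _ vq] [vp' _ vq']; apply/eqP/negPn/negP => pp'.
have Xf x : x \in [set z | cl z == cl v] -> f x = None.
  by rewrite inE => /eqP /fcl ->.
have [s sD W] := clD vv'.
have := vq p' (s + r'); rewrite eq_sym pp' => /(_ isT (approach_walk Xf W vp')).
have := vq' p (s + r) pp' (approach_walk Xf (walk_sym W) vp).
by have := D_gt0; lra.
Qed.

(** Prefixing the edge from [v] turns approaches from [x] into approaches from [v], and its weight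
    cancels in both inequalities. *)
Lemma settled_next f h v x p r : f v = None -> adj G v x -> approach f p x r ->
  settled f h v p (weight G v x + r) -> settled f h x p r.
Proof.
move=> fv vx xp [_ vmin vq]; split=> // [s xs|q s qp xs].
  by have := vmin _ (approach_cons fv vx xs); lra.
by have := vq _ _ qp (approach_cons fv vx xs); lra.
Qed.

(** Costs are measured in units of [5 * D], so the margin 1/2 of [separated] becomes [5 / 2 * D]:
    the [2 * D] of [settled] plus [D / 2] lost in approximating an infimum. *)
Lemma settling_shifts f h : exists2 h' : V -> nat,
  (2 * #|[set v | (f v == None) && ~~ `[< exists p r, settled f h' v p r >]]|
     <= #|[set v | f v == None]|)%N /\
  \sum_p (7 / 6) ^+ h' p <= 8 * \sum_p (7 / 6) ^+ h p :> R &
  forall p, (h p <= h' p)%N.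
Proof.
pose lens p v : classical_sets.set R := fun r => approach f p v r.
pose ok v p := `[< exists r, approach f p v r >].
pose a v p : R := (inf (lens p v) + b p) / (5 * D) - (h p)%:R.
have okU v : v \in [set v | f v == None] -> exists p, ok v p.
  by rewrite inE => /eqP fv; exists v; apply/asboolP; exists 0; apply: approach_self.
have W0 p : 0 < (7 / 6) ^+ h p :> R by rewrite exprn_gt0 //; lra.
have [d [dU dW]] := separating_shifts a okU W0.
exists (fun p => (h p + d p)%N); last by move=> p; rewrite leq_addr.
split; last by under eq_bigr do rewrite exprD.
apply: leq_trans dU; rewrite leq_mul2l /=; apply: subset_leq_card.
apply/fintype.subsetP => v; rewrite !inE => /andP[-> /=]; apply: contra.
move=> /existsP[p /andP[/asboolP okp /forallP sep]]; apply/asboolP.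
have lb q : has_lbound (lens q v) by exists 0 => r /approach_ge0.
have infle q s : approach f q v s -> inf (lens q v) <= s by move=> vs; apply: ge_inf.
have [r vr rinf] : exists2 r, approach f p v r & r < inf (lens p v) + D / 2.
  by apply: inf_adherent; [rewrite divr_gt0|split].
exists p, r; split=> // [s /infle|q s qp vs]; first by have := D_gt0; lra.
have okq : ok v q by apply/asboolP; exists s.
have := sep q; rewrite qp okq /= /a => {}sep.
have D5 : 0 < 5 * D by have := D_gt0; lra.
have := ler_wpM2l (ltW D5) sep; have := infle _ _ vs.
rewrite /handicap !natrD.
have eqD (y : R) : 5 * D * (y / (5 * D)) = y by rewrite mulrC divfK ?gt_eqF.
rewrite !mulrDr !mulrN !eqD; lra.
Qed.

Lemma settling_phase f h k : 0 <= k -> partial_aggregation f h k ->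
  exists f' h', [/\ partial_aggregation f' h' (k + 3 * D),
    (2 * #|[set v | f' v == None]| <= #|[set v | f v == None]|)%N &
    \sum_p (7 / 6) ^+ h' p <= 8 * \sum_p (7 / 6) ^+ h p :> R].
Proof.
move=> k0 fagg; have [fcl fk] := fagg.
have [h' [h'U h'W] hh'] := settling_shifts f h.
pose wins x p := `[< exists v r, cl v = cl x /\ settled f h' v p r >].
pose f' x := if f x is Some q then Some q else [pick p | wins x p].
have f'S x q : f x = Some q -> f' x = Some q by rewrite /f' => ->.
have f'N x v p r : f x = None -> cl v = cl x -> settled f h' v p r -> f' x = Some p.
  move=> fx vx vp; rewrite /f' fx; case: pickP => [p'|/(_ p)].
    move=> /asboolP[v' [r' [v'x v'p']]]; congr Some; apply/esym.
    by apply: (settled_uniq fcl _ _ vp v'p'); rewrite ?v'x // (fcl _ _ vx).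
  by move=> /negP[]; apply/asboolP; exists v, r.
have f'cl x y : cl x = cl y -> f' x = f' y.
  by move=> xy; rewrite /f' (fcl _ _ xy); case: (f y) => //; rewrite /wins xy.
have closed v p r : approach f p v r -> (f v = None -> settled f h' v p r) ->
    walk G (region f' p) v p r.
  elim=> {v r} [fp /(_ fp) pp|v r vp _|v x r fv vx xp IH /(_ fv) vp].
  - by apply: walk_nil; rewrite inE (f'N _ _ _ _ fp erefl pp).
  - by apply: walk_subset vp; apply/fintype.subsetP => x; rewrite !inE => /eqP/f'S ->.
  - apply: walk_cons => //; first by rewrite inE (f'N _ _ _ _ fv erefl vp).
    by apply: IH => _; apply: settled_next vp.
have hle q : handicap h' q <= handicap h q.
  rewrite lerD2l lerN2 ler_wpM2l ?ler_nat // mulr_ge0 //; exact: ltW.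
exists f', h'; split=> //; last first.
  apply: leq_trans h'U; rewrite leq_mul2l /=; apply: subset_leq_card.
  apply/fintype.subsetP => v; rewrite !inE => /eqP f'v.
  case fv : (f v) => [q|] /=; first by rewrite (f'S _ _ fv) in f'v.
  apply/negP => /asboolP[p [r vp]].
  by rewrite (f'N _ _ _ _ fv erefl vp) in f'v.
split=> // x p; case fx : (f x) => [q|].
  rewrite (f'S _ _ fx) => -[<-]; have [r xq rle] := fk _ _ fx.
  exists r; first by apply: closed; [apply: approach_in|rewrite fx].
  by move=> u s /rle; have := hle q; have := D_gt0; lra.
rewrite /f' fx; case: pickP => // p' /asboolP[v [r [vx vp']]] [<-{p}].
have fv : f v = None by rewrite (fcl _ _ vx).
have [s sD xv] := clD (esym vx).
have xv' : walk G (region f' p') x v s.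
  apply: walk_subset xv; apply/fintype.subsetP => y; rewrite !inE => /eqP yx.
  by apply/eqP; apply: f'N vp'; rewrite ?yx // (fcl _ _ yx).
have [vr vmin vq] := vp'.
(* The loss [3 * D]: the cluster is crossed once by the new walk and once in the comparison from
   [v], and [r] is optimal for its portal only up to [D]. *)
exists (s + r); first by apply: walk_cat xv' _; apply: closed vr _.
move=> u t xu.
have vu : walk G setT v u (s + t).
  by apply: walk_cat xu; apply: walk_sym; apply: walk_subset (finset.subsetT _) xv.
have [q [r' [vr' r'le]]] := approach_near k0 fagg vu.
have : r + handicap h' p' <= r' + handicap h' q + D.
  have [qp'|qp'] := eqVneq q p'; last by have := vq _ _ qp' vr'; have := D_gt0; lra.
  by rewrite qp' in vr' *; have := vmin _ vr'; lra.
have := hle q; lra.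
Qed.

Lemma aggregation_phases m : exists f h, [/\ partial_aggregation f h (3 * D * m%:R),
    (2 ^ m * #|[set v | f v == None]| <= #|V|)%N &
    \sum_p (7 / 6) ^+ h p <= #|V|%:R * 8 ^+ m :> R].
Proof.
elim: m => [|m [f [h [fagg fV hV]]]].
  exists (fun=> None), (fun=> 0%N); split; first by split.
    by rewrite expn0 mul1n max_card.
  by rewrite expr0 mulr1 sumr_const -mulr_natl mulr1.
have k0 : 0 <= 3 * D * m%:R by rewrite mulr_ge0 // mulr_ge0 // ltW.
have [f' [h' [fagg' f'V h'V]]] := settling_phase k0 fagg.
exists f', h'; split.
- by rewrite -[m.+1]addn1 natrD mulrDr mulr1.
- by apply: leq_trans fV; rewrite expnSr -mulnA leq_mul2l f'V orbT.
- by apply: le_trans h'V _; rewrite exprS mulrCA ler_wpM2l.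
Qed.

Lemma cluster_aggregation m : (#|V| < 2 ^ m)%N -> exists f : V -> V,
  (forall x y, cl x = cl y -> f x = f y) /\
  forall x, exists2 r, walk G [set y | f y == f x] x (f x) r &
    forall u s, walk G setT x u s -> r + b (f x) <= s + b u + 103 * m%:R * D.
Proof.
move=> Vm; have [f [h [[fcl fk] fV hV]]] := aggregation_phases m.
(* The potential is at most 2^m * 8^m = 16^m, and 16 < (7/6)^20. *)
have hm p : (h p <= 20 * m)%N.
  have : (7 / 6) ^+ h p <= (7 / 6) ^+ (20 * m) :> R.
    apply: le_trans (_ : #|V|%:R * 8 ^+ m <= _).
      apply: le_trans hV; rewrite (bigD1 p) //= lerDl.
      by apply: sumr_ge0 => q _; apply: exprn_ge0; lra.
    apply: le_trans (_ : 2 ^+ m * 8 ^+ m <= _).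
      by rewrite ler_wpM2r ?exprn_ge0 // -natrX ler_nat ltnW.
    rewrite -exprMn exprM lerXn2r ?nnegrE ?exprn_ge0 //; lra.
  by rewrite ler_eXn2l //; lra.
(* After [m] halvings fewer than [2 ^ m] vertices leave none unassigned. *)
have fS x : exists p, f x = Some p.
  case fx : (f x) => [p|]; first by exists p.
  have : (0 < #|[set v | f v == None]|)%N by apply/card_gt0P; exists x; rewrite inE fx.
  move: fV Vm; nia.
have [g gP] := choice fS.
exists g; split=> [x y /fcl|x].
  by rewrite !gP => -[].
have [r xr rle] := fk _ _ (gP x); exists r.
  by apply: walk_subset xr; apply/fintype.subsetP => y; rewrite !inE gP.
move=> u s /rle; rewrite /handicap.
(* In units of [m * D], head starts cost 5 * 20 = 100 and the phases 3, together 103. *)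
have : 5 * D * (h (g x))%:R <= 5 * D * (20 * m)%:R.
  by rewrite ler_wpM2l ?ler_nat // mulr_ge0 // ltW.
by rewrite natrM; lra.
Qed.

End Aggregation.

(** With unit weights, [3 * m] levels exhaust [V] because 27^m * 2^m < 64^m. The term of one vertex
    is at most the whole sum, hence at most 64^m * 2^m = 128^m, and 128 < (3/2)^14. *)
Lemma sparse_levels_log (R : realType) (V : finType) (a : V -> V -> R) m :
  (0 < #|V|)%N -> (#|V| < 2 ^ m)%N ->
  exists2 lev : V -> nat, forall u, (lev u <= 3 * m)%N &
    forall v, (#|[set u | [forall u', (lev u < lev u')%N ==> (a v u < a v u')%R]]|
      <= 14 * m)%N.
Proof.
move=> V0 Vm.
have Sm : (3 ^ (3 * m) * #|[set: V]| < 4 ^ (3 * m))%N.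
  rewrite cardsT; apply: (@leq_trans (3 ^ (3 * m) * 2 ^ m)).
    by rewrite ltn_pmul2l // expn_gt0.
  by rewrite !expnM -expnMn leq_exp2r //; case: (m) Vm V0 => //; case: #|V|.
have [lev levm levw] := sparse_levels a V0 (fun=> ltr01) Sm.
exists lev => // v.
set X := [set u | _]; have : (3 / 2) ^+ #|X| <= (3 / 2) ^+ (14 * m) :> R.
  apply: le_trans (_ : 4 ^+ (3 * m) * #|V|%:R <= _).
    move: levw; rewrite sumr_const; apply: le_trans.
    rewrite (bigD1 v) //= mul1r (_ : [set u in setT | _] = X); last first.
      by apply/setP => u; rewrite !inE; apply: eq_forallb => u'; rewrite inE.
    rewrite lerDl; apply: sumr_ge0 => i _.
    by rewrite mul1r; apply: exprn_ge0; lra.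
  apply: le_trans (_ : 4 ^+ (3 * m) * 2 ^+ m <= _).
    by rewrite ler_wpM2l ?exprn_ge0 // -natrX ler_nat ltnW.
  rewrite !exprM -exprMn lerXn2r ?nnegrE ?mulr_ge0 ?exprn_ge0 //; lra.
by rewrite ler_eXn2l //; lra.
Qed.

(** * Walks versus distances and induced diameters *)

Section Distances.
Variables (R : realType) (V : finType) (G : wgraph R V).
Implicit Types (C : {set V}) (u v x y z : V) (r e : R).

Lemma gdist_le_walk X u v r : walk G X u v r -> (gdist G u v <= r%:E)%E.
Proof.
by move=> /walkP[p [pp lp _ <-]]; apply: ereal_inf_lbound; exists p.
Qed.

(** Distances are infima, so a walk is extracted only below a strictly larger bound. *)
Lemma walk_of_gdist u v r e : (gdist G u v <= r%:E)%E -> r < e ->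
  exists2 s, s < e & walk G setT u v s.
Proof.
move=> uv re; apply: contrapT => nowalk.
suff : (e%:E <= gdist G u v)%E.
  by move=> /le_trans/(_ uv); rewrite lee_fin leNgt re.
apply: le_ereal_inf_tmp => _ [p [pp lp] <-].
rewrite lee_fin leNgt; apply/negP => pe; apply: nowalk; exists (walk_length G u p) => //.
by apply/walkP; exists p; split=> //; apply/allP => x _; exact: in_setT.
Qed.

Lemma connected_walk u v : connected_graph G -> exists r, walk G setT u v r.
Proof.
move=> /(_ u v)/connectP[p pp lp]; exists (walk_length G u p).
by apply/walkP; exists p; split=> //; apply/allP => x _; exact: in_setT.
Qed.

End Distances.

Section InducedWalks.
Variables (R : realType) (V : finType) (G : wgraph R V).
Implicit Types (C : {set V}) (u v x y z : V) (r e : R).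

Lemma walk_induced C u v r : walk G C u v r -> forall (uC : u \in C) (vC : v \in C),
  walk (induced G C) setT (exist _ u uC) (exist _ v vC) r.
Proof.
elim=> {u v r} [u _ uC vC|u v z r _ uv W IH uC zC].
  by rewrite (bool_irrelevance vC uC); apply: walk_nil; rewrite inE.
have vC := walk_source W.
apply: (@walk_cons _ _ (induced G C) _ _ (exist _ v vC)) => //.
Qed.

Lemma induced_walk C (X : {set {x | x \in C}}) (x y : {x | x \in C}) r :
  walk (induced G C) X x y r -> walk G C (val x) (val y) r.
Proof.
elim=> {x y r} [x _|x y z r _ xy _ IH]; first by apply: walk_nil; exact: valP.
by apply: (walk_cons (valP x)) IH.
Qed.

Lemma diameter_induced_le C r :
  (forall x y, x \in C -> y \in C -> exists2 s, s <= r & walk G C x y s) ->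
  (diameter (induced G C) <= r%:E)%E.
Proof.
move=> Cr; apply: ge_ereal_sup => _ [[[x xC] [y yC]] _ <-] /=.
have [s sr W] := Cr _ _ xC yC.
by apply: le_trans (gdist_le_walk (walk_induced W xC yC)) _; rewrite lee_fin.
Qed.

Lemma walk_of_diameter C r e x y : (diameter (induced G C) <= r%:E)%E -> r < e ->
  x \in C -> y \in C -> exists2 s, s < e & walk G C x y s.
Proof.
move=> Cr re xC yC.
have xyr : (gdist (induced G C) (exist _ x xC) (exist _ y yC) <= r%:E)%E.
  by apply: le_trans Cr; apply: ereal_sup_ubound; exists (exist _ x xC, exist _ y yC).
have [s se /induced_walk W] := walk_of_gdist xyr re.
by exists s.
Qed.

End InducedWalks.

(** * The hierarchy *)

Section Coarsening.
Variables (R : realType) (V : finType) (G : wgraph R V).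
Hypothesis Gconn : connected_graph G.
Implicit Types (u v x y : V) (r : R).

Let dist u v := inf (fun r => walk G setT u v r).

Lemma dist_le u v r : walk G setT u v r -> dist u v <= r.
Proof. by move=> uv; apply: ge_inf => //; exists 0 => s /walk_ge0. Qed.

Lemma dist_near u v e : 0 < e -> exists2 r, r < dist u v + e & walk G setT u v r.
Proof.
move=> e0; have [|r uv re] := @inf_adherent R (fun r => walk G setT u v r) e e0.
  by split; [exact: connected_walk|exists 0 => s /walk_ge0].
by exists r.
Qed.

Lemma sparse_coarsening m (P : {set {set V}}) (Delta : R) :
  (0 < #|V|)%N -> (#|V| < 2 ^ m)%N -> 0 < Delta -> partition P setT ->
  (forall C, C \in P -> (diameter (induced G C) <= Delta%:E)%E) ->
  exists2 P', strong_sparse_partition G (2884 * m%:R ^+ 2 * Delta) (56 * m%:R)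
                (14 * m)%:R P' &
    forall C, C \in P -> exists2 C', C' \in P' & C \subset C'.
Proof.
move=> V0 Vm D0 Ppart Pdiam.
have m1 : 1 <= m%:R :> R.
  by rewrite ler1n lt0n; apply/eqP => m0; move: V0 Vm; rewrite m0; case: #|V|.
have mD : m%:R * Delta <= m%:R ^+ 2 * Delta.
  by rewrite ler_pM2r // expr2 ler_peMl // (le_trans ler01).
have [lev lev3m lev14m] := sparse_levels_log dist V0 Vm.
(* The aggregation below loses 103 * m * (2 * Delta) = rho / 2. *)
pose rho := 412 * m%:R * Delta.
pose b v : R := - (rho * (lev v)%:R).
have rho0 : 0 < rho by rewrite /rho; nra.
have covP x : x \in cover P by rewrite (cover_partition Ppart) inE.
have blockP C x : C \in P -> x \in C -> pblock P x = C.
  by move=> CP xC; apply: def_pblock xC => //; case/and3P: Ppart.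
(* The factor 2 gives the strict slack needed to extract a walk from a diameter bound. *)
have clD x y : pblock P x = pblock P y -> exists2 r, r <= 2 * Delta &
    walk G [set z | pblock P z == pblock P x] x y r.
  move=> xy; have D2 : Delta < 2 * Delta by lra.
  have xx : x \in pblock P x by rewrite mem_pblock.
  have yx : y \in pblock P x by rewrite xy mem_pblock.
  have Dx := Pdiam _ (pblock_mem (covP x)).
  have [s /ltW s2 W] := walk_of_diameter Dx D2 xx yx.
  exists s => //; apply: walk_subset W; apply/fintype.subsetP => z zC.
  by rewrite inE (blockP (pblock P x)) // pblock_mem.
have D2 : 0 < 2 * Delta by lra.
have [f [fcl fP]] := cluster_aggregation b D2 clD Vm.
pose P' := preim_partition f setT.
have P'part : partition P' setT := preim_partitionP f setT.
have P'E C : C \in P' -> exists x, C = [set y | f y == f x].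
  move=> /imsetP[x _ ->]; exists x; apply/setP => y.
  by rewrite !inE /= eq_sym.
(* Compare with [x] itself as a portal: levels up to [3 * m] contribute 1236 and the aggregation
   loss 206, together 1442. Diameters are at most twice this. *)
have radius x r : (forall u s, walk G setT x u s ->
    r + b (f x) <= s + b u + 103 * m%:R * (2 * Delta)) -> r <= 1442 * m%:R ^+ 2 * Delta.
  move=> /(_ x 0 (walk_nil G (in_setT x))).
  have : 0 <= rho * (lev x)%:R by rewrite mulr_ge0 // ltW.
  have : rho * (lev (f x))%:R <= rho * (3 * m%:R).
    by rewrite ler_pM2l // -natrM ler_nat.
  have -> : rho * (3 * m%:R) = 1236 * (m%:R ^+ 2 * Delta) by rewrite /rho; ring.
  rewrite /b; lra.
exists P'; first split=> //.
- move=> C /P'E[z ->]; apply: diameter_induced_le => x y; rewrite !inE => /eqP xz /eqP yz.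
  have [r xr /radius rle] := fP x; have [s ys /radius sle] := fP y.
  exists (r + s); first by lra.
  rewrite -xz; apply: walk_cat xr _; rewrite xz -yz; exact: walk_sym.
- move=> v; rewrite ler_nat; apply: leq_trans (lev14m v).
  apply: leq_trans (leq_imset_card (fun p => [set y | f y == p]) _).
  apply/subset_leq_card/fintype.subsetP => C; rewrite !inE => /andP[/P'E[z ->]].
  rewrite -setI_eq0 => /set0Pn[x]; rewrite !inE => /andP[/eqP xz xv].
  apply/imsetP; exists (f x); last by rewrite xz.
  have [r /(walk_subset (finset.subsetT _)) xr rle] := fP x.
  (* The ball has radius 2884 / 56 = 51.5 in units of [m * Delta]; 52 is the strict upper bound. *)
  have {xv} [s sle /walk_sym vx] : exists2 s, s < 52 * m%:R * Delta & walk G setT x v s.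
    apply: (walk_of_gdist xv); rewrite ltr_pdivrMr; last by lra.
    nra.
  rewrite inE; apply/forallP => u; apply/implyP => levu.
  rewrite ltNge; apply/negP => du.
  have [t tle vu] := dist_near v u D0.
  (* A portal [u] of higher level and at least as close to [v] has an advantage of [rho], that is
     412 units of [m * Delta], while the detours and losses amount to at most 2 * 52 + 1 + 206 =
     311. *)
  have := rle _ _ (walk_cat (walk_sym vx) vu).
  have := dist_le (walk_cat vx xr).
  have : rho * ((lev (f x))%:R + 1) <= rho * (lev u)%:R.
    by rewrite ler_pM2l // natr1 ler_nat.
  have rhoE : rho = 412 * (m%:R * Delta) by rewrite /rho mulrA.
  rewrite /b rhoE; nra.
move=> C CP; have [x xC] : exists x, x \in C.
  by apply/set0Pn; apply: contraTneq CP => ->; case/and3P: Ppart.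
have xP' : x \in cover P' by rewrite (cover_partition P'part) inE.
exists (pblock P' x); first exact: pblock_mem.
apply/fintype.subsetP => y yC; rewrite pblock_equivalence_partition ?inE //=.
  by apply/eqP/fcl; rewrite !(blockP C).
by move=> u v w _ _ _; split => // /eqP ->.
Qed.

End Coarsening.

(** * Iterating the coarsening up to a single cluster *)

Section Hierarchy.
Variables (R : realType) (V : finType) (G : wgraph R V).
Hypotheses (V_gt0 : (0 < #|V|)%N) (Gconn : connected_graph G).

(** As [alpha > 1], the ball radius is below the minimum distance, so each ball is a single
    vertex. *)
Lemma singletons_sparse alpha tau :
  (forall u v : V, u != v -> (1%:E <= gdist G u v)%E) -> 1 < alpha -> 1 <= tau ->
  strong_sparse_partition G 1 alpha tau [set [set v] | v : V].
Proof.
move=> G1 alpha1 tau1; split.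
- apply/and3P; split.
  + rewrite eqEsubset finset.subsetT; apply/fintype.subsetP => v _.
    by apply/bigcupP; exists [set v]; [exact: imset_f|rewrite inE].
  + apply/trivIsetP => _ _ /imsetP[u _ ->] /imsetP[v _ ->] uv.
    rewrite disjoints1 inE; apply: contraNN uv => /eqP ->; exact: eqxx.
  + by apply/imsetP => -[v _ /setP/(_ v)]; rewrite !inE eqxx.
- move=> C /imsetP[v _ ->]; apply: diameter_induced_le => x y.
  rewrite !inE => /eqP -> /eqP ->; exists 0 => //; apply: walk_nil; exact: set11.
- move=> v; apply: le_trans tau1; rewrite lern1.
  apply: (@leq_trans #|[set [set v]]|); last by rewrite cards1.
  apply/subset_leq_card/fintype.subsetP => C; rewrite !inE.
  move=> /andP[/imsetP[u _ ->]]; rewrite disjoints1 negbK inE => uv.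
  apply/eqP; congr [set _]; apply/eqP/negPn/negP => /G1/le_trans/(_ uv).
  by rewrite lee_fin leNgt ltr_pdivrMr ?mul1r ?alpha1 // (lt_trans ltr01).
Qed.

Lemma trivial_partition_sparse Delta alpha tau :
  (forall u v, exists2 r, r <= Delta & walk G setT u v r) -> 1 <= tau ->
  strong_sparse_partition G Delta alpha tau [set [set: V]].
Proof.
move=> GD tau1; split.
- have /card_gt0P[v _] := V_gt0.
  rewrite /partition /cover big_set1 eqxx /= inE eq_sym -subset0.
  rewrite /trivIset /cover !big_set1 eqxx /=.
  by apply/negP => /fintype.subsetP/(_ v); rewrite !inE => /(_ isT).
- by move=> C /set1P ->; apply: diameter_induced_le => x y _ _; exact: GD.
- move=> v; apply: le_trans tau1; rewrite lern1.
  apply: (@leq_trans #|[set [set: V]]|); last by rewrite cards1.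
  by apply/subset_leq_card/fintype.subsetP => C; rewrite !inE => /andP[].
Qed.

Lemma bounded_walks : exists B, forall u v, exists2 r, r <= B & walk G setT u v r.
Proof.
have /choice[w wP] : forall x : V * V, exists r, walk G setT x.1 x.2 r.
  by move=> x; exact: connected_walk.
have w0 x : 0 <= w x by exact: walk_ge0 (wP x).
exists (\sum_x w x) => u v; exists (w (u, v)); last exact: wP (u, v).
by rewrite (bigD1 (u, v)) //= lerDl sumr_ge0.
Qed.

Lemma partial_hierarchy m k : (#|V| < 2 ^ m)%N ->
  (forall u v : V, u != v -> (1%:E <= gdist G u v)%E) ->
  exists C : nat -> {set {set V}}, [/\ C 0%N = [set [set v] | v : V],
    forall i, (i <= k)%N -> strong_sparse_partition G
      ((2884 * m%:R ^+ 2) ^+ i) (56 * m%:R) (14 * m)%:R (C i)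
  & forall i, (i < k)%N -> forall U, U \in C i ->
      exists2 U', U' \in C i.+1 & U \subset U'].
Proof.
move=> Vm G1.
have m0 : (0 < m)%N by rewrite lt0n; apply/eqP => m0; move: V_gt0 Vm; rewrite m0; case: #|V|.
have m1 : 1 <= m%:R :> R by rewrite ler1n.
elim: k => [|k [C [C0 Csp Ccoarse]]].
  exists (fun=> [set [set v] | v : V]); split=> // i; rewrite leqn0 => /eqP ->.
  by rewrite expr0; apply: singletons_sparse => //; rewrite ?natrM; lra.
have [Ckpart Ckdiam _] := Csp k (leqnn k).
have g0 : 0 < (2884 * m%:R ^+ 2) ^+ k :> R by apply: exprn_gt0; rewrite expr2; nra.
have [P' P'sp CP'] := sparse_coarsening Gconn V_gt0 Vm g0 Ckpart Ckdiam.
exists (fun i => if (i <= k)%N then C i else P'); split=> // i.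
  case: ifP => [ik _|ik ik1]; first exact: Csp.
  have -> : i = k.+1 by apply/eqP; rewrite eqn_leq ik1 ltnNge ik.
  by rewrite exprS.
rewrite ltnS => ik U; rewrite ik; case: ifP => ik1; first exact: Ccoarse.
have -> : i = k by apply/eqP; rewrite eqn_leq ik leqNgt ik1.
exact: CP'.
Qed.

Lemma hierarchy_exists m : (#|V| < 2 ^ m)%N ->
  (forall u v : V, u != v -> (1%:E <= gdist G u v)%E) ->
  exists k C, sparse_hierarchy G (2884 * m%:R ^+ 2) (56 * m%:R) (14 * m)%:R k C.
Proof.
move=> Vm G1.
have m0 : (0 < m)%N by rewrite lt0n; apply/eqP => m0; move: V_gt0 Vm; rewrite m0; case: #|V|.
have m1 : 1 <= m%:R :> R by rewrite ler1n.
have g1 : 1 < 2884 * m%:R ^+ 2 :> R by rewrite expr2; nra.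
have [B BP] := bounded_walks.
have [k Bk] := geometric_unbounded B g1.
have [C [C0 Csp Ccoarse]] := partial_hierarchy k Vm G1.
(* Since [B] is below the [k]-th power of the ratio, all of [V] is an admissible cluster at level
   [k.+1], and the trivial partition coarsens any other. *)
exists k.+1, (fun i => if (i <= k)%N then C i else [set [set: V]]); split.
- by [].
- by rewrite ltnn.
- move=> i; case: ifP => [ik _|ik ik1]; first exact: Csp.
  have -> : i = k.+1 by apply/eqP; rewrite eqn_leq ik1 ltnNge ik.
  apply: trivial_partition_sparse; last by rewrite natrM; lra.
  move=> u v; have [r rB W] := BP u v; exists r => //.
  by apply: le_trans rB _; apply: le_trans (ltW Bk) _; rewrite ler_weXn2l // ltW.
- move=> i; rewrite ltnS => ik U; rewrite ik; case: ifP => ik1; first exact: Ccoarse.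
  by exists [set: V]; rewrite ?inE ?finset.subsetT.
Qed.

End Hierarchy.

Unset Implicit Arguments.

Theorem theorem6p1 (R : realType) :
  exists K : R, forall (V : finType) (G : wgraph R V),
    (2 <= #|V|)%N -> connected_graph G -> min_distance_one G ->
    exists alpha tau gamma : R,
      [/\ 0 < alpha,
          alpha <= K * ln (#|V|%:R),
          tau <= K * ln (#|V|%:R),
          gamma <= K * ln (#|V|%:R) ^+ 2
        & exists (k : nat) (C : nat -> {set {set V}}),
            sparse_hierarchy G gamma alpha tau k C].
Proof.
have ln2 : 0 < ln 2 :> R by rewrite ln_gt0 // ltr1n.
pose q : R := 2 / ln 2; have q0 : 0 < q by rewrite divr_gt0.
(* The term [q] serves the two linear bounds and [q ^+ 2] the quadratic one. *)
exists (2884 * (q + q ^+ 2)) => V G V2 Gconn [_ G1].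
have V0 : (0 < #|V|)%N := ltnW V2.
pose e := trunc_log 2 #|V|.
have Ve : (#|V| < 2 ^ e.+1)%N by exact: trunc_log_ltn.
have e0 : (0 < e)%N by rewrite trunc_log_gt0.
(* From [0 < e] follows [e.+1 <= 2 * e], and [e] is at most the binary logarithm of [#|V|]. *)
have mln : e.+1%:R <= q * ln (#|V|%:R) :> R.
  apply: le_trans (_ : 2 * e%:R <= _); first by rewrite -natrM ler_nat; lia.
  rewrite /q mulrAC -mulrA ler_pM2l // ler_pdivlMr // mulr_natl -lnXn //.
  rewrite ler_ln ?posrE ?exprn_gt0 ?ltr0n // -natrX ler_nat; exact: trunc_logP.
set l := ln _ in mln *.
have l0 : 0 < l by rewrite ln_gt0 // ltr1n.
have m0 : 0 < e.+1%:R :> R by rewrite ltr0n.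
exists (56 * e.+1%:R), (14 * e.+1)%:R, (2884 * e.+1%:R ^+ 2); split.
- by rewrite mulr_gt0.
- have : 0 <= q ^+ 2 * l by rewrite mulr_ge0 ?exprn_ge0 // ltW.
  by rewrite mulrDr mulrDl; lra.
- have : 0 <= q ^+ 2 * l by rewrite mulr_ge0 ?exprn_ge0 // ltW.
  by rewrite natrM mulrDr mulrDl; lra.
- have : 0 <= q * l ^+ 2 by rewrite mulr_ge0 ?exprn_ge0 // ltW.
  have : e.+1%:R ^+ 2 <= q ^+ 2 * l ^+ 2.
    by rewrite -exprMn; apply: lerXn2r; rewrite ?nnegrE // ltW // mulr_gt0.
  by rewrite mulrDr mulrDl; lra.
- exact: hierarchy_exists.
Qed.
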